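(* There exist finitely generated groups $\Gamma$ endowed with length functions $L$ which are quasi-isometric to word-lengths, such that (1) $\Gamma$ has the radial rapid decay property (RRD) with respect to $L$ but does not have the rapid decay property (RD) with respect to $L$; (2) $\Gamma$ contains a subgroup which does not have RRD with respect to some word-length (on that subgroup, associated with a finite symmetric generating set of it).
   Context: A length function on a discrete group $\Gamma$ with identity $e$ is a map $L:\Gamma\to\mathbb{R}_+$ with $L(e)=0$, $L(g^{-1})=L(g)$, $L(gh)\le L(g)+L(h)$; it is proper if $\{g:L(g)\le t\}$ is finite for all $t\ge 0$. A word-length on a finitely generated group is the length function associated with a finite symmetric generating set. Two length functions $L,L'$ on $\Gamma$ are quasi-isometric if there is $C\ge1$ with $C^{-1}L'-C\le L\le CL'+C$ on $\Gamma$. For a proper length function $L$: $\mathbb{C}[\Gamma]$ is the space of finitely supported functions on $\Gamma$; $f\in\mathbb{C}[\Gamma]$ is radial if $L(g_1)=L(g_2)$ implies $f(g_1)=f(g_2)$; for $f\ne0$, $L(f)=\max\{L(g):g\in\operatorname{supp}f\}$; $\Vert f\Vert_{op}$ is the norm of $\xi\mapsto f*\xi$ on $\ell^2(\Gamma)$, with $(f*\xi)(g)=\sum_hf(h)\xi(h^{-1}g)$. $\Gamma$ has RD with respect to $L$ if there is $P\in\mathbb{R}[X]$ with $\Vert f\Vert_{op}\le P(L(f))\Vert f\Vert_2$ for all nonzero $f\in\mathbb{C}[\Gamma]$; it has RRD with respect to $L$ if there is $P\in\mathbb{R}[X]$ such that this inequality holds for all nonzero radial $f\in\mathbb{C}[\Gamma]$.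 *)

(* Defs.v *)
From HB Require Import structures.
From mathcomp Require Export all_boot all_order all_algebra.
From mathcomp Require Export all_classical all_reals all_analysis.
From mathcomp Require Export complex.

Set Implicit Arguments.
Unset Strict Implicit.
Unset Printing Implicit Defensive.

Import Order.TTheory GRing.Theory Num.Theory.

Local Open Scope classical_set_scope.
Local Open Scope ring_scope.

(* [groupType] is the type of arbitrary, possibly infinite, groups; the group
   operations live in %g. *)

Section LengthFunctions.
Variables (R : realType) (G : groupType).
Implicit Types (L : G -> R) (S : set G).

Record length_function L : Prop := LengthFunction {
  length_ge0 : forall g, 0 <= L g;
  length1 : L 1%g = 0;
  lengthV : forall g, L (g^-1)%g = L g;
  lengthM : forall g h, L (g * h)%g <= L g + L h }.

Definition proper_length L : Prop :=
  forall t : R, 0 <= t -> finite_set [set g | L g <= t].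

Definition words S (g : G) : set (seq G) :=
  [set w : seq G | (forall s, s \in w -> S s) /\ (\prod_(s <- w) s)%g = g].

Record finite_symmetric_generating S : Prop := FiniteSymmetricGenerating {
  gen_finite : finite_set S;
  gen_symmetric : forall s, S s -> S (s^-1)%g;
  gen_generates : forall g, words S g !=set0 }.

(* When S generates, the infimum is over a nonempty set of natural numbers,
   hence is a minimum. *)
Definition word_length S (g : G) : R :=
  inf [set (size w)%:R | w in words S g].

Definition quasi_isometric L L' : Prop :=
  exists2 C : R, 1 <= C &
    forall g, C^-1 * L' g - C <= L g /\ L g <= C * L' g + C.

End LengthFunctions.

Definition finitely_generated (G : groupType) : Prop :=
  exists S : set G, finite_symmetric_generating S.

Section RapidDecay.
Variables (R : realType) (G : groupType).
Implicit Types (L : G -> R) (f xi : G -> R[i]).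

Definition supp f : set G := [set g | f g != 0].

Definition finitely_supported f : Prop := finite_set (supp f).

Definition radial L f : Prop :=
  forall g1 g2, L g1 = L g2 -> f g1 = f g2.

(* Meant for f nonzero and finitely supported, when the supremum is a maximum. *)
Definition fun_length L f : R := sup (L @` supp f).

(* The \sum_(_ \in _) of fsbigop is a finite sum only if the summand has finite
   support, which is the case for f finitely supported. *)
Definition convolution f xi (g : G) : R[i] :=
  \sum_(h \in [set: G]) f h * xi (h^-1 * g)%g.

(* Equal to +oo outside l^2(G). *)
Definition l2norm xi : \bar R :=
  sqrte (\esum_(g in [set: G]) ((Normc.normc (xi g) ^+ 2)%:E)).

Definition opnorm f : \bar R :=
  ereal_sup [set l2norm (convolution f xi) | xi in
              [set xi | (l2norm xi <= 1)%E]].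

Definition decay_bound L (P : {poly R}) f : Prop :=
  (opnorm f <= (P.[fun_length L f])%:E * l2norm f)%E.

Definition has_RD L : Prop :=
  exists P : {poly R}, forall f,
    finitely_supported f -> supp f !=set0 -> decay_bound L P f.

Definition has_RRD L : Prop :=
  exists P : {poly R}, forall f,
    finitely_supported f -> supp f !=set0 -> radial L f -> decay_bound L P f.

End RapidDecay.

(* Main.v *)
From HB Require Import structures.
Require Import Defs.
From mathcomp Require Import finmap.
From mathcomp Require Import ring lra zify.

(** The group is a product [G = H * F] with the word length
    [ell (a, b) = |a| + |b|].  Here [H] is the lamplighter group, generated by
    three elements, and [F] is the free product of [s ^ 2 + 1] copies of the
    group with two elements, for [s = 3].  Thus a sphere of radius [n] has at
    most [s ^ n] elements in [H] and at least [s ^ (2 * n)] elements in [F].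

    RRD holds because a radial function cannot concentrate on [H].  Its value
    at [g] is repeated on a sphere of [1 * F], whence
    [|f g| <= ||f||_2 * s ^- ell g], and it remains to bound the convolution
    by [s ^- ell] restricted to a ball of radius [N].  The Schur test
    ([schur_test]) applies with the weight [w (a, b) = s ^- |b|].  In the
    factor [F] the sum to estimate is a walk on a regular tree of degree
    [s ^ 2 + 1], where a step away from the root divides [w] by [s] and is
    offered by at most [s ^ 2 + 1] letters, while at most one letter leads
    back ([fi_sphere_weight]).  In the factor [H] the sum is
    [\sum_(|a| <= N) s ^- |a| <= N + 1].  The growth of [F] being at least the
    square of that of [H] is exactly what makes this last sum polynomial.
    [product_has_RRD] gives the polynomial [('X + 1) ^+ 3].

    RD fails for [G], and RRD fails for [H], because [H] is amenable of
    exponential growth.  The ball [B] of radius [2 * n] in [H] has at least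
    [2 ^ n] elements, and amenability provides finite sets [E0] and [E] with
    [B * E0] inside [E] and [#|E| <= 2 * #|E0|] ([lamp_folner]).  Convolving
    the indicators of [B] and [E0] shows that the indicator of [B] has operator
    norm at least [#|B| / 2] ([opnorm_indicator_ge]), although its l2 norm is
    only the square root of [#|B|].  In [H] this indicator is radial; in [G]
    its image is merely finitely supported. *)

Set Implicit Arguments.
Unset Strict Implicit.
Unset Printing Implicit Defensive.

Import Order.TTheory GRing.Theory Num.Theory.

Local Open Scope complex_scope.
Local Open Scope classical_set_scope.
Local Open Scope ring_scope.

(** * Finite sums *)

Section FiniteSums.
Variable R : realType.

(** Adding one term at a time, so as to avoid square roots of the weights. *)
Lemma weighted_cauchy_schwarz (I : eqType) (r : seq I) (c w x : I -> R) :
  (forall i, i \in r -> 0 <= c i) -> (forall i, i \in r -> 0 < w i) ->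
  (\sum_(i <- r) c i * x i) ^+ 2 <=
  (\sum_(i <- r) c i * w i) * (\sum_(i <- r) c i * (x i ^+ 2 / w i)).
Proof.
move=> c_ge0 w_gt0; suff [] : [/\ 0 <= \sum_(i <- r) c i * w i,
    0 <= \sum_(i <- r) c i * (x i ^+ 2 / w i) &
    (\sum_(i <- r) c i * x i) ^+ 2 <=
      (\sum_(i <- r) c i * w i) * (\sum_(i <- r) c i * (x i ^+ 2 / w i))] by [].
elim: r c_ge0 w_gt0 => [|i r IHr] c_ge0 w_gt0.
  by rewrite !big_nil expr0n mul0r.
have ci := c_ge0 _ (mem_head i r); have wi := w_gt0 _ (mem_head i r).
have [|j jr|A_ge0 B_ge0 SAB] := IHr.
- by move=> j jr; apply: c_ge0; rewrite inE jr orbT.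
- by apply: w_gt0; rewrite inE jr orbT.
rewrite !big_cons.
set A := \sum_(j <- r) _ in A_ge0 SAB *.
set B := \sum_(j <- r) _ in B_ge0 SAB *.
set S := \sum_(j <- r) _ in SAB *.
set u := x i / w i.
have xE : x i = u * w i by rewrite /u divfK ?gt_eqF.
have -> : x i ^+ 2 / w i = u ^+ 2 * w i.
  by rewrite xE; field; rewrite gt_eqF.
(* As a polynomial in u, this has discriminant 4 (S ^ 2 - A B) <= 0. *)
have key : 0 <= A * u ^+ 2 + B - 2 * S * u.
  have [A0|A_neq0] := eqVneq A 0.
    have -> : S = 0.
      by apply/eqP; rewrite -sqrf_eq0 eq_le sqr_ge0 andbT (le_trans SAB) ?A0 ?mul0r.
    by rewrite A0; lra.
  have A_gt0 : 0 < A by rewrite lt_def A_neq0.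
  rewrite -(pmulr_rge0 _ A_gt0).
  have : 0 <= (A * u - S) ^+ 2 by exact: sqr_ge0.
  have -> : (A * u - S) ^+ 2 = A * (A * u ^+ 2 - 2 * S * u) + S ^+ 2 by ring.
  by rewrite mulrBr !mulrDr; lra.
have wi_ge0 := ltW wi.
split; first by rewrite addr_ge0 // mulr_ge0.
  by rewrite addr_ge0 // mulr_ge0 // mulr_ge0 // sqr_ge0.
rewrite xE.
have -> : (c i * (u * w i) + S) ^+ 2 = S ^+ 2 + c i * w i * (2 * S * u)
    + (c i * w i) ^+ 2 * u ^+ 2 by ring.
have -> : (c i * w i + A) * (c i * (u ^+ 2 * w i) + B) =
    A * B + c i * w i * (A * u ^+ 2 + B) + (c i * w i) ^+ 2 * u ^+ 2 by ring.
have : 0 <= c i * w i * (A * u ^+ 2 + B - 2 * S * u).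
  by rewrite !mulr_ge0.
by rewrite mulrBr; lra.
Qed.

Lemma ler_sum_seq_sub (I : eqType) (r r' : seq I) (F : I -> R) :
  uniq r -> {subset r <= r'} -> (forall i, i \in r' -> 0 <= F i) ->
  \sum_(i <- r) F i <= \sum_(i <- r') F i.
Proof.
elim: r r' => [|x r IHr] r' /=.
  by move=> _ _ F0; rewrite big_nil big_seq sumr_ge0.
move=> /andP[xr ur] rr' F0.
have xr' : x \in r' by rewrite rr' ?mem_head.
rewrite (perm_big _ (perm_to_rem xr')) !big_cons lerD2l; apply: IHr => //.
  move=> y yr; have yx : y != x by apply: contraNneq xr => <-.
  have := rr' y; rewrite inE yr orbT => /(_ isT).
  by rewrite (perm_mem (perm_to_rem xr')) inE (negPf yx).
by move=> y /mem_rem; exact: F0.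
Qed.

Lemma normc_sum (I : Type) (r : seq I) (F : I -> R[i]) :
  Normc.normc (\sum_(i <- r) F i) <= \sum_(i <- r) Normc.normc (F i).
Proof.
elim: r => [|i r IHr]; first by rewrite !big_nil Normc.normc0.
by rewrite !big_cons (le_trans (le_normcD _ _)) // lerD2l.
Qed.

Lemma normc_ge0 (x : R[i]) : 0 <= Normc.normc x.
Proof. by case: x => a b; rewrite /Normc.normc sqrtr_ge0. Qed.

Lemma normc_real (x : R) : Normc.normc x%:C = `|x|.
Proof. by rewrite /Normc.normc /= expr0n addr0 sqrtr_sqr. Qed.

Lemma esumZ_le (T : choiceType) (c : R) (a : T -> R) :
  0 <= c -> (forall x, 0 <= a x) ->
  (\esum_(x in [set: T]) (c * a x)%:E <= c%:E * \esum_(x in [set: T]) (a x)%:E)%E.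
Proof.
move=> c_ge0 a_ge0; apply: ge_ereal_sup => _ [A [finA _] <-].
rewrite fsbig_finite //=; under eq_bigr do rewrite EFinM.
rewrite -ge0_sume_distrr; last by move=> x _; rewrite lee_fin.
apply: lee_wpmul2l; first by rewrite lee_fin.
by apply: esum_ge; exists A; rewrite // fsbig_finite.
Qed.

End FiniteSums.

(** * Bounds on the operator norm of a convolution *)

Section OperatorNorm.
Variables (R : realType) (G : groupType).
Implicit Types (f xi : G -> R[i]) (Z B E : seq G).

Local Notation normc := (@Normc.normc R).

Lemma convolutionE f xi Z g : uniq Z -> (forall h, f h != 0 -> h \in Z) ->
  convolution f xi g = \sum_(h <- Z) f h * xi (h^-1 * g)%g.
Proof.
move=> uZ fZ; rewrite /convolution (fsbigE Z) //=.
  by apply: eq_bigl => h; rewrite in_setT.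
move=> h _ hZ; have [->|/fZ] := eqVneq (f h) 0; first by rewrite mul0r.
by rewrite (negPf hZ).
Qed.

Lemma l2norm_finite xi Z : uniq Z -> (forall h, xi h != 0 -> h \in Z) ->
  l2norm xi = (Num.sqrt (\sum_(h <- Z) normc (xi h) ^+ 2))%:E.
Proof.
move=> uZ xiZ; rewrite /l2norm.
have -> : (\esum_(g in [set: G]) ((normc (xi g) ^+ 2)%:E) =
           \esum_(g in [set` Z]) ((normc (xi g) ^+ 2)%:E))%E.
  rewrite [RHS]esum_mkcond; apply: eq_esum => g _.
  rewrite mem_setE; case: ifPn => // gZ.
  have [->|/xiZ] := eqVneq (xi g) 0; last by rewrite (negPf gZ).
  by rewrite Normc.normc0 expr0n.
rewrite esum_fset; first last.
- by move=> h _; rewrite lee_fin sqr_ge0.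
- exact: finite_seq.
by rewrite -fsbig_seq // sumEFin.
Qed.

(** The Cauchy-Schwarz inequality weighted by [w] bounds [|f * xi| ^ 2] at [g] by
    [M * w g] times a convolution of [|f|] with [|xi| ^ 2 / w], thanks to the
    first sum; once [g] is summed over and replaced by [h * x], the second sum
    yields another factor [M].  The weight need not be square summable. *)
Lemma schur_test f Z (w : G -> R) (M : R) : uniq Z ->
  (forall h, f h != 0 -> h \in Z) -> (forall g, 0 < w g) ->
  (forall x, \sum_(h <- Z) normc (f h) * w (h^-1 * x)%g <= M * w x) ->
  (forall x, \sum_(h <- Z) normc (f h) * w (h * x)%g <= M * w x) ->
  (opnorm f <= M%:E)%E.
Proof.
move=> uZ fZ w_gt0 row col.
have M_ge0 : 0 <= M.
  have := row 1%g; rewrite -(pmulr_lge0 _ (w_gt0 1%g)); apply: le_trans.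
  by apply: sumr_ge0 => h _; rewrite mulr_ge0 ?normc_ge0 ?ltW.
apply: ge_ereal_sup => _ [xi xi_le1 <-].
have -> : M%:E = sqrte (M ^+ 2)%:E by rewrite /= sqrtr_sqr ger0_norm.
rewrite /l2norm lee_sqrt ?lee_fin ?sqr_ge0 //.
pose v x := normc (xi x) ^+ 2 / w x.
have v_ge0 x : 0 <= v x by rewrite divr_ge0 ?sqr_ge0 ?ltW.
have term_ge0 h g x : (0 <= (normc (f h) * (M * w g * v x))%:E)%E.
  rewrite lee_fin mulr_ge0 ?normc_ge0 // mulr_ge0 ?v_ge0 //.
  by rewrite mulr_ge0 // ltW.
have norm_xi_le1 : (\esum_(g in [set: G]) (normc (xi g) ^+ 2)%:E <= 1)%E.
  rewrite -lee_sqrt //; first by rewrite /= sqrtr1.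
have pointwise g : normc (convolution f xi g) ^+ 2 <=
    \sum_(h <- Z) normc (f h) * (M * w g * v (h^-1 * g)%g).
  rewrite (convolutionE _ _ uZ fZ).
  apply: (@le_trans _ _
    ((\sum_(h <- Z) normc (f h) * normc (xi (h^-1 * g)%g)) ^+ 2)).
    rewrite ler_pXn2r ?nnegrE ?normc_ge0 //; last first.
      by apply: sumr_ge0 => h _; rewrite mulr_ge0 ?normc_ge0.
    rewrite (le_trans (normc_sum _ _)) //.
    by apply: ler_sum => h _; rewrite Normc.normcM.
  apply: (le_trans (weighted_cauchy_schwarz (w := fun h => w (h^-1 * g)%g)
    _ _ _)) => [h _|h _|]; rewrite ?normc_ge0 //.
  under [leRHS]eq_bigr do rewrite mulrCA.
  rewrite -mulr_sumr ler_wpM2r //.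
  by apply: sumr_ge0 => h _; rewrite mulr_ge0 ?normc_ge0 ?v_ge0.
apply: (@le_trans _ _ (\esum_(g in [set: G]) \sum_(h <- Z)
    (normc (f h) * (M * w g * v (h^-1 * g)%g))%:E)%E).
  by apply: le_esum => g _; rewrite sumEFin lee_fin.
rewrite esum_sum; last first.
  by move=> g h _ _; exact: term_ge0.
have translate h : (\esum_(g in [set: G])
      (normc (f h) * (M * w g * v (h^-1 * g)%g))%:E =
    \esum_(x in [set: G]) (normc (f h) * (M * w (h * x)%g * v x))%:E)%E.
  rewrite (@reindex_esum _ _ _ [set: G] [set: G] (fun x => h * x)%g).
    by apply: eq_esum => x _; rewrite mulKg.
  split=> //; first by move=> x y _ _ /mulgI.
  by move=> y _; exists (h^-1 * y)%g; rewrite ?mulVKg.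
under eq_bigr do rewrite translate.
rewrite -esum_sum; last first.
  by move=> g h _ _; exact: term_ge0.
apply: (@le_trans _ _ (\esum_(x in [set: G]) (M ^+ 2 * normc (xi x) ^+ 2)%:E)%E).
  apply: le_esum => x _; rewrite sumEFin lee_fin.
  have -> : \sum_(h <- Z) normc (f h) * (M * w (h * x)%g * v x) =
      (M * v x) * \sum_(h <- Z) normc (f h) * w (h * x)%g.
    by rewrite mulr_sumr; apply: eq_bigr => h _; ring.
  apply: (le_trans (ler_wpM2l _ (col x))); first by rewrite mulr_ge0.
  rewrite /v le_eqVlt; apply/orP; left; apply/eqP; field.
  by rewrite gt_eqF.
apply: (le_trans (esumZ_le _ _)) => [|x|]; rewrite ?sqr_ge0 //.
by rewrite -[leRHS]mule1 lee_wpmul2l // lee_fin sqr_ge0.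
Qed.

Definition indicator B (g : G) : R[i] := (g \in B)%:R.

Lemma normc_indicator B g : normc (indicator B g) = (g \in B)%:R.
Proof.
by rewrite /indicator; case: (g \in B); rewrite ?Normc.normc1 ?Normc.normc0.
Qed.

Lemma l2norm_indicator B : uniq B ->
  l2norm (indicator B) = (Num.sqrt (size B)%:R)%:E.
Proof.
move=> uB; rewrite (l2norm_finite uB); last first.
  by move=> h; rewrite /indicator; case: (h \in B); rewrite ?eqxx.
congr (Num.sqrt _)%:E; rewrite -sum1_size natr_sum !big_seq.
by apply: eq_bigr => g gB; rewrite normc_indicator gB expr1n.
Qed.

(** The convolution of the indicators of [B] and [E0] has total mass
    [#|B| * #|E0|] and lives on [E], so its squared l2 norm is at least
    [(#|B| * #|E0|) ^ 2 / #|E| >= #|B| ^ 2 / 2 * #|E0|]. *)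
Lemma opnorm_indicator_ge B E0 E : uniq B -> uniq E0 -> uniq E ->
  E0 != [::] -> (size E <= 2 * size E0)%N ->
  (forall b e, b \in B -> e \in E0 -> (b * e)%g \in E) ->
  (((size B)%:R / 2)%:E <= opnorm (indicator B : G -> R[i]))%E.
Proof.
move=> uB uE0 uE E0_neq0 size_le BE0.
have sE0_gt0 : 0 < (size E0)%:R :> R by rewrite ltr0n lt0n size_eq0.
pose c : R := (Num.sqrt (size E0)%:R)^-1.
have c_ge0 : 0 <= c by rewrite invr_ge0 sqrtr_ge0.
have c2 : c ^+ 2 = (size E0)%:R^-1 by rewrite exprVn sqr_sqrtr // ltW.
pose xi g : R[i] := c%:C * indicator E0 g.
have xi_norm : (l2norm xi <= 1)%E.
  rewrite (l2norm_finite uE0); last first.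
    by move=> h; rewrite /xi /indicator; case: (h \in E0); rewrite ?mulr0 ?eqxx.
  rewrite lee_fin -[leRHS]sqrtr1 ler_sqrt //.
  rewrite (eq_big_seq (fun=> c ^+ 2)); last first.
    move=> g gE0; rewrite Normc.normcM normc_indicator gE0 mulr1.
    by rewrite normc_real ger0_norm.
  rewrite big_const_seq count_predT iter_addr_0 -[_ *+ _]mulr_natr c2.
  by rewrite mulVf // gt_eqF.
apply: (@le_trans _ _ (l2norm (convolution (indicator B) xi))); last first.
  by apply: ereal_sup_ubound; exists xi.
have -> : ((size B)%:R / 2)%:E = sqrte (((size B)%:R / 2 : R) ^+ 2)%:E.
  by rewrite /= sqrtr_sqr ger0_norm // divr_ge0.
rewrite /l2norm lee_sqrt; last by apply: esum_ge0 => g _; rewrite lee_fin sqr_ge0.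
apply: esum_ge; exists [set` E]; first by split=> //; exact: finite_seq.
rewrite -fsbig_seq // sumEFin lee_fin.
(* Up to the constant c, the value of the convolution at g. *)
pose N g : nat := (\sum_(b <- B) ((b^-1 * g)%g \in E0))%N.
have conv g : normc (convolution (indicator B) xi g) = c * (N g)%:R.
  rewrite (convolutionE _ _ uB); last first.
    by move=> h; rewrite /indicator; case: (h \in B); rewrite ?eqxx.
  have -> : \sum_(h <- B) indicator B h * xi (h^-1 * g)%g = (c * (N g)%:R)%:C.
    rewrite rmorphM rmorph_nat /N natr_sum mulr_sumr; apply: eq_big_seq => h hB.
    by rewrite /xi /indicator hB mul1r.
  by rewrite normc_real ger0_norm // mulr_ge0.
have sumN : (\sum_(g <- E) N g)%N = (size B * size E0)%N.
  rewrite exchange_big /= -sum1_size big_distrl /=.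
  apply: eq_big_seq => b bB; rewrite mul1n.
  rewrite -big_mkcond /= sum1_count -size_filter -(size_map (fun e => b * e)%g E0).
  apply: perm_size; apply: uniq_perm.
  - exact: filter_uniq.
  - by rewrite map_inj_uniq //; exact: mulgI.
  - move=> g; rewrite mem_filter; apply/andP/mapP => [[gE0 gE]|[e eE0 ->]].
      by exists (b^-1 * g)%g; rewrite ?mulVKg.
    by rewrite mulKg eE0 BE0.
have CS := @weighted_cauchy_schwarz R G E (fun=> 1) (fun=> 1)
  (fun g => c * (N g)%:R) (fun _ _ => ler01) (fun _ _ => ltr01).
move: CS; under eq_bigr do rewrite mul1r.
under [X in _ <= X * _]eq_bigr do rewrite mulr1.
under [X in _ <= _ * X]eq_bigr do rewrite mul1r divr1.
rewrite -mulr_sumr -natr_sum sumN.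
have -> : \sum_(g <- E) 1 = (size E)%:R :> R by rewrite -sum1_size natr_sum.
rewrite exprMn c2.
under [X in _ -> _ <= X]eq_bigr do rewrite conv.
set Q := \sum_(g <- E) _ => CS.
have Q_ge0 : 0 <= Q by apply: sumr_ge0 => g _; rewrite sqr_ge0.
have sizeR : (size E)%:R <= 2 * (size E0)%:R :> R by rewrite -natrM ler_nat.
have : (size B)%:R ^+ 2 * (size E0)%:R <= 2 * (size E0)%:R * Q.
  apply: le_trans (ler_wpM2r Q_ge0 sizeR); apply: le_trans CS.
  by rewrite natrM le_eqVlt; apply/orP; left; apply/eqP; field; rewrite gt_eqF.
rewrite [2 * _ * _]mulrAC ler_pM2r // => BQ.
have -> : ((size B)%:R / 2 : R) ^+ 2 = (size B)%:R ^+ 2 / 4 by field.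
have := sqr_ge0 ((size B)%:R : R); lra.
Qed.

End OperatorNorm.

(** * Word norms with natural values *)

Section NormBall.
Variables (G : eqType) (ell : G -> nat) (sph : nat -> seq G).
Hypothesis sphP : forall n g, (g \in sph n) = (ell g == n).

(** The enumeration [sph] of the spheres is left open, because those of [H] come
    from arbitrary words and those of [F] from reduced words. *)
Definition norm_ball (n : nat) : seq G := flatten [seq sph j | j <- iota 0 n.+1].

Lemma mem_norm_ball n g : (g \in norm_ball n) = (ell g <= n)%N.
Proof.
apply/flatten_mapP/idP => [[j]|le_n].
  by rewrite mem_iota sphP => /andP[_ jn] /eqP ->.
by exists (ell g); rewrite ?mem_iota ?sphP.
Qed.

Lemma norm_ball_uniq n : (forall j, uniq (sph j)) -> uniq (norm_ball n).
Proof.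
move=> usph; rewrite /norm_ball; elim: n.+1 0%N => [|m IHm] k //=.
rewrite cat_uniq usph IHm andbT /=.
apply/hasPn => g /flatten_mapP[j]; rewrite mem_iota => /andP[kj _].
by rewrite !sphP => /eqP ->; rewrite gtn_eqF.
Qed.

Lemma big_norm_ball (V : nmodType) n (F : G -> V) :
  \sum_(g <- norm_ball n) F g = \sum_(j < n.+1) \sum_(g <- sph j) F g.
Proof.
by rewrite big_flatten big_map -[iota _ _]/(index_iota 0 n.+1) big_mkord.
Qed.

End NormBall.

Section WordNorm.
Variable G : groupType.
Implicit Types (S : set G) (ell : G -> nat) (g h : G).

(** The infimum defining [word_length] is attained: this predicate records its
    natural value together with the two properties that characterize it. *)
Record word_norm S ell : Prop := WordNorm {
  norm_attained : forall g, exists2 u, words S g u & size u = ell g;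
  norm_minimal : forall g u, words S g u -> (ell g <= size u)%N }.

Lemma words1 S : words S 1%g [::].
Proof. by split; rewrite ?big_nil. Qed.

Lemma words_cons S s g u : S s -> words S g u -> words S (s * g)%g (s :: u).
Proof.
move=> Ss [Su gE]; split; last by rewrite big_cons gE.
by move=> t; rewrite inE => /orP[/eqP->|/Su].
Qed.

Lemma words_cat S g h u v :
  words S g u -> words S h v -> words S (g * h)%g (u ++ v).
Proof.
move=> [Su gE] [Sv hE]; split; last by rewrite big_cat /= gE hE.
by move=> s; rewrite mem_cat => /orP[/Su|/Sv].
Qed.

Lemma words_inv S g u : (forall s, S s -> S (s^-1)%g) ->
  words S g u -> words S (g^-1)%g (rev [seq (s^-1)%g | s <- u]).
Proof.
move=> SV [Su gE]; split.
  by move=> s; rewrite mem_rev => /mapP[t /Su /SV tu ->].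
by rewrite -map_rev big_map prodgV revK gE.
Qed.

Lemma exists_word_norm S : finite_symmetric_generating S ->
  exists ell, word_norm S ell.
Proof.
move=> [_ _ gen].
have minimal g : exists n : nat, (exists2 u, words S g u & size u = n) /\
    forall u, words S g u -> (n <= size u)%N.
  pose P n := `[< exists2 u, words S g u & size u = n >].
  have exP : exists n, P n.
    by case: (gen g) => u Su; exists (size u); apply/asboolP; exists u.
  exists (ex_minn exP); case: ex_minnP => n /asboolP Pn n_min; split=> // u Su.
  by apply: n_min; apply/asboolP; exists u.
have [ell ellP] := boolp.choice minimal.
by exists ell; split=> g; case: (ellP g).
Qed.

Lemma word_lengthE (R : realType) S ell : word_norm S ell ->
  word_length R S = (fun g => (ell g)%:R).
Proof.
move=> [att mini]; apply/funext => g; rewrite /word_length.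
have [u Su uE] := att g.
have lb : lbound [set (size w)%:R | w in words S g] ((ell g)%:R : R).
  by move=> _ [v Sv <-]; rewrite ler_nat mini.
apply/eqP; rewrite eq_le; apply/andP; split.
  by apply: ge_inf; [exists (ell g)%:R | exists u; rewrite ?uE].
by apply: lb_le_inf => //; exists (size u)%:R, u.
Qed.

Section Theory.
Variables (S : set G) (ell : G -> nat).
Hypotheses (genS : finite_symmetric_generating S) (ellP : word_norm S ell).

Lemma norm1 : ell 1%g = 0%N.
Proof. by apply/eqP; rewrite -leqn0 (norm_minimal ellP (words1 S)). Qed.

Lemma normV g : ell (g^-1)%g = ell g.
Proof.
have normV_le h : (ell (h^-1)%g <= ell h)%N.
  have [u Su <-] := norm_attained ellP h.
  apply: leq_trans (norm_minimal ellP (words_inv (gen_symmetric genS) Su)) _.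
  by rewrite size_rev size_map.
by apply/eqP; rewrite eqn_leq normV_le -{1}(invgK g) normV_le.
Qed.

Lemma normM g h : (ell (g * h)%g <= ell g + ell h)%N.
Proof.
have [[u Su <-] [v Sv <-]] := (norm_attained ellP g, norm_attained ellP h).
by rewrite -size_cat (norm_minimal ellP (words_cat Su Sv)).
Qed.

Lemma norm_gen s : S s -> (ell s <= 1)%N.
Proof.
by move=> Ss; have := norm_minimal ellP (words_cons Ss (words1 S)); rewrite mulg1.
Qed.

Lemma norm_length_function (R : realType) :
  length_function (fun g => (ell g)%:R : R).
Proof.
split=> [g||g|g h]; rewrite ?ler0n ?norm1 ?normV //.
by rewrite -natrD ler_nat normM.
Qed.

(** Repetitions are kept, which makes the number of entries exactly
    [size ts ^ n], an upper bound for the size of a sphere. *)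
Fixpoint word_products (ts : seq G) (n : nat) : seq G :=
  if n is n'.+1 then [seq (s * g)%g | s <- ts, g <- word_products ts n']
  else [:: 1%g].

Lemma size_word_products ts n : size (word_products ts n) = (size ts ^ n)%N.
Proof. by elim: n => //= n IHn; rewrite size_allpairs IHn expnS. Qed.

Lemma mem_word_products ts g u : (forall s, S s -> s \in ts) ->
  words S g u -> g \in word_products ts (size u).
Proof.
move=> Sts; elim: u g => [|s u IHu] g [Su <-]; first by rewrite big_nil inE.
rewrite big_cons; apply: allpairs_f.
  by apply/Sts/Su; rewrite mem_head.
by apply: IHu; split=> // t tu; apply: Su; rewrite inE tu orbT.
Qed.

Definition word_sphere (ts : seq G) (n : nat) : seq G :=
  [seq g <- undup (word_products ts n) | ell g == n].

Lemma word_sphere_uniq ts n : uniq (word_sphere ts n).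
Proof. by rewrite filter_uniq ?undup_uniq. Qed.

Lemma size_word_sphere_le ts n : (size (word_sphere ts n) <= size ts ^ n)%N.
Proof.
rewrite size_filter (leq_trans (count_size _ _)) //.
by rewrite (leq_trans (size_undup _)) ?size_word_products.
Qed.

Lemma mem_word_sphere ts n g : (forall s, S s -> s \in ts) ->
  (g \in word_sphere ts n) = (ell g == n).
Proof.
move=> Sts; rewrite mem_filter mem_undup; apply: andb_idr => /eqP <-.
by have [u Su <-] := norm_attained ellP g; apply: mem_word_products.
Qed.

Lemma norm_proper (R : realType) : proper_length (fun g => (ell g)%:R : R).
Proof.
have Sts s : S s -> s \in fset_set S.
  by move=> Ss; rewrite in_fset_set; [exact: mem_set|exact: gen_finite genS].
move=> t t_ge0; pose sph := word_sphere (fset_set S).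
apply: (sub_finite_set _ (finite_seq (norm_ball sph (Num.truncn t)))) => g /= gt.
rewrite (@mem_norm_ball _ ell) ?truncn_ge_nat // => n h.
exact: mem_word_sphere.
Qed.

End Theory.
End WordNorm.

Section ProductNorm.
Variables (G H : groupType) (S : set G) (T : set H).
Variables (ellG : G -> nat) (ellH : H -> nat).
Hypotheses (genS : finite_symmetric_generating S) (normS : word_norm S ellG).
Hypotheses (genT : finite_symmetric_generating T) (normT : word_norm T ellH).

Definition product_gen : set (G * H) :=
  [set (s, 1%g) | s in S] `|` [set (1%g, t) | t in T].

Definition product_norm (g : G * H) : nat := (ellG g.1 + ellH g.2)%N.

(** Generators of the two factors commute, so a shortest word is a shortest word
    for one coordinate followed by a shortest word for the other. *)
Lemma product_word_norm : word_norm product_gen product_norm.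
Proof.
split=> [[a b]|g u].
  have [u Su uE] := norm_attained normS a.
  have [v Tv vE] := norm_attained normT b.
  exists ([seq (s, 1%g) | s <- u] ++ [seq (1%g, t) | t <- v]); last first.
    by rewrite size_cat !size_map uE vE.
  have -> : (a, b) = ((a, 1) * (1, b))%g by congr (_, _); rewrite ?mulg1 ?mul1g.
  case: Su => Su <-; case: Tv => Tv <-.
  apply: words_cat; split.
  - by move=> _ /mapP[s /Su Ss ->]; left; exists s.
  - elim: (u) => [|s r IHr]; first by rewrite !big_nil.
    by rewrite /= !big_cons IHr; congr (_, _); rewrite /= mulg1.
  - by move=> _ /mapP[t /Tv Tt ->]; right; exists t.
  - elim: (v) => [|s r IHr]; first by rewrite !big_nil.
    by rewrite /= !big_cons IHr; congr (_, _); rewrite /= mulg1.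
elim: u g => [|s u IHu] g [Su <-].
  by rewrite big_nil /product_norm /= (norm1 normS) (norm1 normT).
rewrite big_cons /=; set p := (\prod_(t <- u) t)%g.
have {}IHu : (product_norm p <= size u)%N.
  by apply: IHu; split=> // t tu; apply: Su; rewrite inE tu orbT.
apply: (@leq_trans (product_norm s + product_norm p)); last first.
  rewrite -add1n leq_add //; case: (Su s (mem_head _ _)) => -[t Tt <-].
    by rewrite /product_norm /= (norm1 normT) addn0 (norm_gen normS).
  by rewrite /product_norm /= (norm1 normS) (norm_gen normT).
rewrite /product_norm addnACA leq_add //.
  exact: (normM normS).
exact: (normM normT).
Qed.

Lemma product_generating : finite_symmetric_generating product_gen.
Proof.
split.
- rewrite finite_setU; split; apply: finite_image.
    exact: gen_finite genS.
  exact: gen_finite genT.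
- move=> _ [[s Ss <-]|[t Tt <-]].
    left; exists (s^-1)%g; first exact: (gen_symmetric genS).
    by congr (_, _); rewrite invg1.
  right; exists (t^-1)%g; first exact: (gen_symmetric genT).
  by congr (_, _); rewrite invg1.
- by move=> g; have [u Su _] := norm_attained product_word_norm g; exists u.
Qed.

End ProductNorm.

(** * Free products of groups of order two *)

Section FreeProduct.
Variable X : finType.
Implicit Types (x y : X) (u v w : seq X).

Definition reduced u : bool := sorted (fun x y => x != y) u.

(** Each letter acts on reduced words by an involution.  Products of reduced
    words are defined by this action, which makes associativity a consequence of
    the compatibility of [reduce_cat] with [push]. *)
Definition push x u : seq X :=
  if u is y :: v then if x == y then v else x :: u else [:: x].

Definition reduce_cat u v : seq X := foldr push v u.

Lemma reduced_behead x u : reduced (x :: u) -> reduced u.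
Proof. by case: u => //= y u /andP[]. Qed.

Lemma push_reduced x u : reduced u -> reduced (push x u).
Proof.
case: u => //= y u ru; have [_|xy] := eqVneq x y; last by rewrite /= xy.
exact: reduced_behead ru.
Qed.

Lemma push_cons x u : reduced (x :: u) -> push x u = x :: u.
Proof. by case: u => //= y u /andP[/negPf->]. Qed.

Lemma pushK x u : reduced u -> push x (push x u) = u.
Proof.
case: u => [|y u] ru /=; first by rewrite eqxx.
have [->|xy] := eqVneq x y; last by rewrite /= eqxx.
exact: push_cons.
Qed.

Lemma reduce_cat_reduced u v : reduced v -> reduced (reduce_cat u v).
Proof. by move=> rv; elim: u => //= x u IHu; exact: push_reduced. Qed.

Lemma reduce_cat_push x u v : reduced v ->
  reduce_cat (push x u) v = push x (reduce_cat u v).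
Proof.
move=> rv; case: u => //= y u; have [->|//] := eqVneq x y.
by rewrite pushK ?reduce_cat_reduced.
Qed.

Lemma reduce_catA u v w : reduced w ->
  reduce_cat u (reduce_cat v w) = reduce_cat (reduce_cat u v) w.
Proof. by move=> rw; elim: u => //= x u ->; rewrite reduce_cat_push. Qed.

Lemma reduce_cats0 u : reduced u -> reduce_cat u [::] = u.
Proof.
elim: u => //= x u IHu ru; rewrite IHu ?push_cons //.
exact: reduced_behead ru.
Qed.

Lemma reduce_cat_cat u v w : reduce_cat (u ++ v) w = reduce_cat u (reduce_cat v w).
Proof. exact: foldr_cat. Qed.

Lemma reduce_cat_rev u v : reduced v -> reduce_cat (rev u) (reduce_cat u v) = v.
Proof.
move=> rv; elim: u => //= x u IHu.
by rewrite rev_cons -cats1 reduce_cat_cat /= pushK ?reduce_cat_reduced.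
Qed.

Lemma rev_reduced u : reduced u -> reduced (rev u).
Proof.
rewrite /reduced rev_sorted; congr sorted.
by apply/funext => x; apply/funext => y; rewrite eq_sym.
Qed.

Record free_involutions := FreeInvolutions {
  reduced_word : seq X;
  reduced_wordP : reduced reduced_word }.

HB.instance Definition _ := [isSub for reduced_word].
HB.instance Definition _ := [Choice of free_involutions by <:].

Implicit Types a b c : free_involutions.

Definition fi_one : free_involutions := @FreeInvolutions [::] isT.
Definition fi_mul a b : free_involutions :=
  FreeInvolutions (reduce_cat_reduced (reduced_word a) (reduced_wordP b)).
Definition fi_inv a : free_involutions :=
  FreeInvolutions (rev_reduced (reduced_wordP a)).

Lemma fi_mulA : associative fi_mul.
Proof.
by move=> a b c; apply/val_inj/reduce_catA/reduced_wordP.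
Qed.

Lemma fi_mul1 : left_id fi_one fi_mul.
Proof. by move=> a; apply/val_inj. Qed.

Lemma fi_mulr1 : right_id fi_one fi_mul.
Proof. by move=> a; apply/val_inj/reduce_cats0/reduced_wordP. Qed.

Lemma fi_mulV : left_inverse fi_one fi_inv fi_mul.
Proof.
move=> a; apply/val_inj => /=.
rewrite -[X in reduce_cat _ X](reduce_cats0 (reduced_wordP a)).
exact: reduce_cat_rev.
Qed.

Lemma fi_mulrV : right_inverse fi_one fi_inv fi_mul.
Proof.
move=> a; apply/val_inj => /=; set u := reduced_word a.
rewrite -{1}[u]revK -[X in reduce_cat _ X]reduce_cats0 ?reduce_cat_rev //.
exact/rev_reduced/reduced_wordP.
Qed.

HB.instance Definition _ := isGroup.Build free_involutions
  fi_mulA fi_mul1 fi_mulr1 fi_mulV fi_mulrV.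

Definition letter x : free_involutions := @FreeInvolutions [:: x] isT.

Definition fi_size a : nat := size (reduced_word a).

Lemma size_push x u : (size (push x u) <= (size u).+1)%N.
Proof. by case: u => //= y u; case: eqP => //= _; rewrite ltnW. Qed.

Lemma reduced_word_letter x a :
  reduced_word (letter x * a)%g = push x (reduced_word a).
Proof. by []. Qed.

Lemma fi_word_norm : word_norm [set letter x | x in [set: X]] fi_size.
Proof.
split=> [[u ru]|a w [+ <-]].
  exists (map letter u); last by rewrite size_map.
  split; first by move=> _ /mapP[x _ ->]; exists x.
  apply: val_inj => /=; elim: u ru => [|x u IHu] ru; first by rewrite big_nil.
  rewrite big_cons reduced_word_letter IHu ?push_cons //.
  exact: reduced_behead ru.
elim: w => [|s w IHw] ws; first by rewrite big_nil.
rewrite big_cons; have [x _ <-] := ws _ (mem_head s w).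
rewrite /fi_size reduced_word_letter (leq_trans (size_push _ _)) // ltnS.
by apply: IHw => t tw; apply: ws; rewrite inE tw orbT.
Qed.

Lemma fi_generating : finite_symmetric_generating [set letter x | x in [set: X]].
Proof.
split.
- exact: finite_image.
- by move=> _ [x _ <-]; exists x => //; apply: val_inj.
- by move=> a; have [u Su _] := norm_attained fi_word_norm a; exists u.
Qed.

(** Reduced words of length [n] whose first letter is not [p]; forbidding the
    letter just read makes the enumeration a recursion on [n]. *)
Fixpoint reduced_words (n : nat) (p : option X) : seq (seq X) :=
  if n is n'.+1 then
    flatten [seq [seq x :: u | u <- reduced_words n' (Some x)]
            | x <- enum X & Some x != p]
  else [:: [::]].

Definition avoids_head (p : option X) u : bool :=
  if u is x :: _ then Some x != p else true.

Lemma reduced_cons x u : reduced (x :: u) = reduced u && avoids_head (Some x) u.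
Proof. by case: u => //= y u; rewrite andbC eq_sym. Qed.

Lemma mem_reduced_words n p u : (u \in reduced_words n p) =
  [&& size u == n, reduced u & avoids_head p u].
Proof.
elim: n p u => [|n IHn] p u; first by case: u.
apply/flatten_mapP/and3P => [[x]|[]].
  rewrite mem_filter => /andP[xp _] /mapP[v].
  rewrite IHn => /and3P[/eqP <- rv vx] ->.
  by rewrite reduced_cons rv.
case: u => // x u /eqP[sizeu]; rewrite reduced_cons => /andP[ru xu] /= xp.
exists x; first by rewrite mem_filter xp mem_enum.
by apply: map_f; rewrite IHn sizeu eqxx ru.
Qed.

Lemma big_reduced_words (V : nmodType) n p (F : seq X -> V) :
  \sum_(u <- reduced_words n.+1 p) F u =
  \sum_(x | Some x != p) \sum_(u <- reduced_words n (Some x)) F (x :: u).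
Proof.
rewrite /= big_flatten big_map big_filter big_enum_cond.
by apply: eq_bigr => x _; rewrite big_map.
Qed.

Lemma reduced_words_uniq n p : uniq (reduced_words n p).
Proof.
elim: n p => [|n IHn] p //=.
apply: (@allpairs_uniq_dep _ _ _ (fun x u => x :: u) _
  (fun x => reduced_words n (Some x))).
- by rewrite filter_uniq ?enum_uniq.
- by move=> x _.
- by move=> [x u] [y v] _ _ /= [-> ->].
Qed.

Definition fi_sphere n : seq free_involutions := pmap insub (reduced_words n None).

Lemma map_fi_sphere n : map reduced_word (fi_sphere n) = reduced_words n None.
Proof.
rewrite /fi_sphere (pmap_filter (insubK _)).
apply/all_filterP/allP => u; rewrite mem_reduced_words => /and3P[_ ru _].
by rewrite isSome_insub.
Qed.

Lemma mem_fi_sphere n a : (a \in fi_sphere n) = (fi_size a == n).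
Proof.
case: a => u ru.
rewrite -(mem_map val_inj) map_fi_sphere mem_reduced_words /fi_size /= ru.
by case: u {ru} => [|x u]; rewrite /= andbT.
Qed.

Lemma fi_sphere_uniq n : uniq (fi_sphere n).
Proof. by rewrite -(map_inj_uniq val_inj) map_fi_sphere reduced_words_uniq. Qed.

Section Growth.
Variables (R : realType) (s : nat).
Hypotheses (s_gt0 : (0 < s)%N) (cardX : #|X| = (s ^ 2).+1).

Let S_gt0 : 0 < s%:R :> R. Proof. by rewrite ltr0n. Qed.

Lemma card_avoid x : #|[pred y | Some y != Some x]| = (s ^ 2)%N.
Proof.
by have := cardC1 x; rewrite cardX /= => <-; apply: eq_card => y; rewrite !inE.
Qed.

Lemma size_reduced_words n p : (s ^ (2 * n) <= size (reduced_words n p))%N.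
Proof.
elim: n p => [|n IHn] p //.
rewrite -sum1_size big_reduced_words mulnS expnD.
apply: (@leq_trans (\sum_(x | Some x != p) s ^ (2 * n))%N); last first.
  by apply: leq_sum => x _; rewrite sum1_size IHn.
rewrite sum_nat_const leq_mul2r; apply/orP; right.
case: p => [y|]; first by rewrite card_avoid.
by rewrite (eq_card (B := X)) // cardX.
Qed.

Definition weight u : R := s%:R ^- size u.

Lemma weight_cons x u : weight u = s%:R * weight (x :: u).
Proof. by rewrite /weight /= exprS invfM mulrA divff ?mul1r // gt_eqF. Qed.

Lemma weight_gt0 u : 0 < weight u.
Proof. by rewrite invr_gt0 exprn_gt0. Qed.

(** The word [rev u] represents the inverse of [u], whose letters act on
    [x :: v] from the first letter of [u] on.  As [u] does not begin with [x],
    nothing ever cancels: each of the [s ^ (2 * n)] words reaches distance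
    [n + size (x :: v)] from the root. *)
Lemma weight_sum_avoiding n x v : reduced (x :: v) ->
  \sum_(u <- reduced_words n (Some x)) weight (reduce_cat (rev u) (x :: v)) =
  s%:R ^+ n * weight (x :: v).
Proof.
elim: n x v => [|n IHn] x v rxv; first by rewrite big_seq1 mul1r.
rewrite big_reduced_words.
rewrite (eq_bigr (fun=> s%:R ^+ n * (s%:R^-1 * weight (x :: v)))) => [|y yx].
  rewrite big_const iter_addr_0 card_avoid -(mulr_natr _ (s ^ 2)%N) natrX.
  rewrite [s%:R ^+ n.+1]exprS expr2; move: (s%:R ^+ n) (weight _) => E W.
  by field; rewrite gt_eqF.
under eq_bigr do rewrite rev_cons -cats1 reduce_cat_cat.
have {}yx : y != x by apply: contraNneq yx => ->.
rewrite /= (negPf yx) IHn; last by rewrite /= yx.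
by rewrite (weight_cons y (x :: v)) mulKf // gt_eqF.
Qed.

(** The first letter of [u] either cancels the head of [v], which happens for one
    letter at most and leaves a sum over shorter words, or it starts a walk away
    from the root.  There are [s ^ 2 + 1 <= 2 * s ^ 2] letters of the second
    kind, so the constant grows by two at each step. *)
Lemma weight_sum_le n p v : reduced v ->
  \sum_(u <- reduced_words n p) weight (reduce_cat (rev u) v) <=
  (2 * n + 1)%:R * s%:R ^+ n * weight v.
Proof.
elim: n p v => [|n IHn] p v ry; first by rewrite big_seq1 !mul1r.
rewrite big_reduced_words.
(* C is the contribution of a letter that does not cancel and A bounds that of
   the letter that does. *)
pose C := s%:R ^+ n * (s%:R^-1 * weight v).
pose A := (2 * n + 1)%:R * s%:R ^+ n.+1 * weight v.
have C_ge0 : 0 <= C by rewrite !mulr_ge0 ?invr_ge0 ?exprn_ge0 ?ltW ?weight_gt0.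
have A_ge0 : 0 <= A by rewrite !mulr_ge0 ?exprn_ge0 ?ltW ?weight_gt0.
apply: (@le_trans _ _ (\sum_(x : X) ((if Some x == ohead v then A else 0) + C))).
  apply: (@le_trans _ _ (\sum_(x | Some x != p)
    ((if Some x == ohead v then A else 0) + C))); last first.
    rewrite [leRHS](bigID (fun x => Some x != p)) /= lerDl sumr_ge0 // => x _.
    by rewrite addr_ge0 //; case: ifP.
  apply: ler_sum => x _.
  under eq_bigr do rewrite rev_cons -cats1 reduce_cat_cat.
  have [xy|xy] := eqVneq (Some x) (ohead v).
    case: v xy ry @A @C A_ge0 C_ge0 => // z v [->] ry A C A_ge0 C_ge0.
    rewrite /= eqxx; apply: (le_trans (IHn _ _ _)); first exact: reduced_behead ry.
    rewrite (weight_cons z v) -[leLHS]addr0 lerD // le_eqVlt; apply/orP; left.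
    by rewrite /A exprS; apply/eqP; ring.
  have pushE : reduce_cat [:: x] v = x :: v.
    case: v xy {ry A C A_ge0 C_ge0} => [|z v] /= xz; first by [].
    by rewrite ifN //; apply: contraNneq xz => ->.
  rewrite pushE weight_sum_avoiding; last by rewrite -pushE reduce_cat_reduced.
  by rewrite add0r /C (weight_cons x v) mulKf ?gt_eqF.
rewrite big_split /= sumr_const cardX.
have -> : \sum_(x : X) (if Some x == ohead v then A else 0) =
          if v is _ :: _ then A else 0.
  move: A {C C_ge0 A_ge0} => A; case: v {ry} => [|z v]; first by rewrite big1.
  by rewrite -big_mkcond (big_pred1 z).
apply: (@le_trans _ _ (A + C *+ (2 * s ^ 2))).
  apply: lerD; first by case: (v).
  by rewrite ler_wpMn2l //; nia.
rewrite -[C *+ _]mulr_natr natrM natrX /A /C [s%:R ^+ n.+1]exprS expr2.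
rewrite [X in _ <= X * _ * _](_ : _ = (2 * n + 1)%:R + 2); last first.
  by rewrite -natrD; congr _%:R; lia.
move: (s%:R ^+ n) (weight v) (2 * n + 1)%:R => E W K.
by rewrite le_eqVlt; apply/orP; left; apply/eqP; field; rewrite gt_eqF.
Qed.

Lemma size_fi_sphere n : (s ^ (2 * n) <= size (fi_sphere n))%N.
Proof. by rewrite -(size_map reduced_word) map_fi_sphere size_reduced_words. Qed.

Lemma fi_sphere_weight n b :
  \sum_(a <- fi_sphere n) s%:R ^- fi_size (a^-1 * b)%g <=
  (2 * n + 1)%:R * s%:R ^+ n * s%:R ^- fi_size b :> R.
Proof.
have := weight_sum_le n None (reduced_wordP b).
by rewrite -map_fi_sphere big_map.
Qed.

End Growth.
End FreeProduct.

(** * Criteria for rapid decay and for its failure *)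

Section PolynomialGrowth.
Variable R : realType.

Lemma horner_le_pow (P : {poly R}) : exists2 C : R, 0 <= C &
  forall x, 0 <= x -> `|P.[x]| <= C * (1 + x) ^+ size P.
Proof.
exists (\sum_(i < size P) `|P`_i|) => [|x x_ge0]; first exact: sumr_ge0.
have x1 : 1 <= 1 + x by rewrite lerDl.
rewrite horner_coef (le_trans (ler_norm_sum _ _ _)) // mulr_suml.
apply: ler_sum => i _; rewrite normrM ler_wpM2l // normrX ger0_norm //.
apply: (@le_trans _ _ ((1 + x) ^+ i)).
  by rewrite lerXn2r ?nnegrE ?lerDr ?addr_ge0.
by rewrite ler_weXn2l // ltnW.
Qed.

Lemma exponential_beats_poly (P : {poly R}) :
  exists n : nat, forall x, 0 <= x <= (2 * n)%:R -> 4 * P.[x] ^+ 2 < (2 ^ n)%:R.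
Proof.
have [C C_ge0 CP] := horner_le_pow P.
(* For n a multiple m (D + 1) the power 2 ^ n is at least (m + 1) ^ (D + 1), and
   one factor m + 1 absorbs all the constants. *)
pose D := (size P * 2)%N; pose K := 4 * C ^+ 2 * (2 * D.+1)%:R ^+ D.
pose m := Num.truncn K; exists (m * D.+1)%N => x /andP[x_ge0 x_le].
apply: (@le_lt_trans _ _ (4 * C ^+ 2 * (1 + x) ^+ D)).
  rewrite -mulrA ler_pM2l // exprM -exprMn -(real_normK (num_real P.[x])).
  by rewrite lerXn2r ?nnegrE ?mulr_ge0 ?exprn_ge0 ?addr_ge0 ?CP.
have x1 : 1 + x <= (2 * D.+1)%:R * m.+1%:R.
  rewrite -natrM (le_trans (lerD (lexx 1) x_le)) //.
  by rewrite -[1]/(1%:R) -natrD ler_nat; nia.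
apply: (@le_lt_trans _ _ (K * m.+1%:R ^+ D)).
  rewrite /K -[leRHS]mulrA ler_wpM2l ?mulr_ge0 ?sqr_ge0 // -exprMn.
  by rewrite lerXn2r ?nnegrE ?mulr_ge0 ?addr_ge0.
apply: (@lt_le_trans _ _ (m.+1%:R ^+ D.+1)).
  by rewrite exprS ltr_pM2r ?exprn_gt0 // truncnS_gt.
by rewrite -natrX ler_nat expnM leq_exp2r // ltn_expl.
Qed.

End PolynomialGrowth.

Section DecayCriteria.
Variables (R : realType) (G : groupType).

Lemma fun_length_ge (L : G -> R) (f : G -> R[i]) g :
  finitely_supported f -> f g != 0 -> L g <= fun_length L f.
Proof.
move=> finf fg; apply: ub_le_sup; last by exists g.
have finI : finite_set (L @` supp f) by exact: finite_image.
exists (\sum_(x <- fset_set (L @` supp f)) `|x|) => x Lx.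
have xI : x \in fset_set (L @` supp f) by rewrite in_fset_set //; exact: mem_set.
by rewrite (big_rem _ xI) /= (le_trans (ler_norm _)) // lerDl sumr_ge0.
Qed.

(** Large spheres make the values of a radial function small,
    [|f g| <= ||f||_2 * s ^- ell g], after which the Schur test only concerns the
    function [s ^- ell].  Symmetry of [ell] turns the second sum of that test
    into the first one.  The sets [Z N] may be larger than balls. *)
Lemma has_RRD_of_weight (ell : G -> nat) (s : R) (w : G -> R) (Z : nat -> seq G)
    (d : nat) :
  0 < s -> (forall g, ell (g^-1)%g = ell g) ->
  (forall g, exists r : seq G, [/\ uniq r, {in r, forall h, ell h = ell g} &
    s ^+ (2 * ell g) <= (size r)%:R]) ->
  (forall N, uniq (Z N)) -> (forall N g, (ell g <= N)%N -> g \in Z N) ->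
  (forall N g, g \in Z N -> (g^-1)%g \in Z N) -> (forall g, 0 < w g) ->
  (forall N x, \sum_(h <- Z N) s ^- ell h * w (h^-1 * x)%g <= N.+1%:R ^+ d * w x) ->
  has_RRD (fun g => (ell g)%:R : R).
Proof.
move=> s_gt0 ellV large uZ ballZ ZV w_gt0 weight.
exists (('X + 1) ^+ d) => f finf [g0 fg0] radf.
set L := fun g => (ell g)%:R in radf *.
set l := fun_length L f.
have l_ge0 : 0 <= l by rewrite (le_trans _ (fun_length_ge L finf fg0)) ?ler0n.
(* The length of f is only known as a real supremum, while norms are natural. *)
pose N := Num.truncn l.
have ell_le g : f g != 0 -> (ell g <= N)%N.
  by move=> fg; rewrite truncn_ge_nat // (fun_length_ge L finf fg).
have fZ g : f g != 0 -> g \in Z N by move=> /ell_le/ballZ.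
pose F := Num.sqrt (\sum_(h <- Z N) Normc.normc (f h) ^+ 2).
have F_ge0 : 0 <= F by exact: sqrtr_ge0.
have f_le g : Normc.normc (f g) <= F * s ^- ell g.
  have [->|fg] := eqVneq (f g) 0.
    by rewrite Normc.normc0 mulr_ge0 // invr_ge0 exprn_ge0 // ltW.
  have [r [ur rg size_r]] := large g.
  rewrite ler_pdivlMr ?exprn_gt0 // -[leLHS]ger0_norm; last first.
    by rewrite mulr_ge0 ?normc_ge0 // exprn_ge0 // ltW.
  rewrite -sqrtr_sqr ler_sqrt; last by apply: sumr_ge0 => h _; rewrite sqr_ge0.
  have rZ : {subset r <= Z N} by move=> h /rg hg; rewrite ballZ // hg ell_le.
  apply: le_trans (ler_sum_seq_sub ur rZ _); last by move=> h _; rewrite sqr_ge0.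
  rewrite (eq_big_seq (fun=> Normc.normc (f g) ^+ 2)) => [|h /rg hg].
    rewrite big_const_seq count_predT iter_addr_0 -[leRHS]mulr_natr exprMn.
    by rewrite ler_wpM2l ?sqr_ge0 // -exprM mulnC.
  by rewrite (radf h g) // /L hg.
have row x : \sum_(h <- Z N) Normc.normc (f h) * w (h^-1 * x)%g <=
    N.+1%:R ^+ d * F * w x.
  rewrite mulrAC mulrC; apply: le_trans (ler_wpM2l F_ge0 (weight N x)).
  rewrite mulr_sumr; apply: ler_sum => h _; rewrite mulrA.
  by rewrite ler_wpM2r // ltW.
have col x : \sum_(h <- Z N) Normc.normc (f h) * w (h * x)%g <=
    N.+1%:R ^+ d * F * w x.
  apply: le_trans (row x); rewrite le_eqVlt; apply/orP; left; apply/eqP.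
  have permZ : perm_eq [seq (h^-1)%g | h <- Z N] (Z N).
    apply: uniq_perm => //; first by rewrite map_inj_uniq //; exact: invg_inj.
    move=> h; apply/mapP/idP => [[k kZ ->]|hZ]; first exact: ZV.
    by exists (h^-1)%g; rewrite ?invgK ?ZV.
  rewrite -(perm_big _ permZ) big_map; apply: eq_bigr => h _.
  by rewrite (radf (h^-1)%g h) // /L ellV.
rewrite /decay_bound (l2norm_finite (uZ N) fZ) -/F.
apply: (le_trans (schur_test (uZ N) fZ w_gt0 row col)).
rewrite -EFinM lee_fin ler_wpM2r // !hornerE /= lerXn2r ?nnegrE ?addr_ge0 //.
by rewrite -natr1 lerD2r truncn_le.
Qed.

Lemma supp_indicator (B : seq G) : supp (indicator R B) = [set` B].
Proof.
apply/seteqP; split=> g /=; rewrite /supp /indicator /=.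
  by case: (g \in B) => //=; rewrite eqxx.
by move=> ->; rewrite oner_eq0.
Qed.

Lemma finitely_supported_indicator (B : seq G) : finitely_supported (indicator R B).
Proof. by rewrite /finitely_supported supp_indicator; exact: finite_seq. Qed.

(** The operator norm of the indicator is linear in the size of [B], its l2 norm
    only a square root. *)
Lemma decay_indicator_size (L : G -> R) (P : {poly R}) (B E0 E : seq G) (c : R) :
  uniq B -> B != [::] -> uniq E0 -> uniq E ->
  E0 != [::] -> (size E <= 2 * size E0)%N ->
  (forall b e, b \in B -> e \in E0 -> (b * e)%g \in E) ->
  (forall b, b \in B -> 0 <= L b <= c) ->
  decay_bound L P (indicator R B) ->
  exists2 x, 0 <= x <= c & (size B)%:R <= 4 * P.[x] ^+ 2.
Proof.
move=> uB B_neq0 uE0 uE E0_neq0 size_le BE0 LB decay.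
set l := fun_length L (indicator R B).
have suppB := supp_indicator B; have finB := finitely_supported_indicator B.
have [b bB] : exists b, b \in B.
  case: B B_neq0 {uB BE0 LB decay l suppB finB} => // b B _.
  by exists b; rewrite mem_head.
exists l.
  apply/andP; split.
    have /andP[Lb _] := LB b bB; apply: le_trans Lb (fun_length_ge L finB _).
    by rewrite /indicator bB oner_eq0.
  apply: ge_sup; first by exists (L b), b; rewrite // suppB.
  by move=> _ [g + <-]; rewrite suppB => /LB/andP[].
have := le_trans (opnorm_indicator_ge R uB uE0 uE E0_neq0 size_le BE0) decay.
rewrite l2norm_indicator // -EFinM lee_fin -/l.
set n : R := (size B)%:R.
have n_gt0 : 0 < n by rewrite ltr0n lt0n size_eq0.
set q := Num.sqrt n; have q_gt0 : 0 < q by rewrite sqrtr_gt0.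
have nE : n = q ^+ 2 by rewrite sqr_sqrtr // ltW.
rewrite {1}nE expr2 mulrAC ler_pM2r // => qP.
have Pq : 0 <= P.[l] by rewrite (le_trans _ qP) // divr_ge0 // ltW.
rewrite nE; nra.
Qed.

(** The radius [n] depends on [P] alone, so that [B] may then be chosen as a whole
    ball, with a radial indicator, or as the image of a ball of a subgroup. *)
Lemma decay_bound_fails (L : G -> R) (P : {poly R}) :
  exists n : nat, forall B E0 E : seq G,
    [/\ uniq B, (2 ^ n <= size B)%N &
      forall b, b \in B -> (0 <= L b <= (2 * n)%:R)%R] ->
    [/\ uniq E0, uniq E, E0 != [::], (size E <= 2 * size E0)%N &
      forall b e, b \in B -> e \in E0 -> (b * e)%g \in E] ->
    supp (indicator R B) !=set0 /\ ~ decay_bound L P (indicator R B).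
Proof.
have [n Pn] := exponential_beats_poly P; exists n.
move=> B E0 E [uB sB LB] [uE0 uE E0_neq0 sE BE0].
have B_neq0 : B != [::] by rewrite -size_eq0 -lt0n (leq_trans _ sB) ?expn_gt0.
split.
  rewrite supp_indicator; case: B B_neq0 {uB sB LB BE0} => // b B _.
  by exists b; rewrite /= mem_head.
move=> /(decay_indicator_size uB B_neq0 uE0 uE E0_neq0 sE BE0 LB)[x /Pn x_lt].
by move=> /le_lt_trans/(_ x_lt); rewrite ltr_nat ltnNge sB.
Qed.

End DecayCriteria.

(** * Radial rapid decay of products with a fast-growing free product *)

Section ProductRRD.
Variables (R : realType) (H : groupType) (T : set H) (ellH : H -> nat).
Variables (ts : seq H) (s : nat) (X : finType).
Hypotheses (genT : finite_symmetric_generating T) (normT : word_norm T ellH).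
Hypotheses (Tts : forall t, T t -> t \in ts) (ts_le : (size ts <= s)%N).
Hypotheses (s_gt0 : (0 < s)%N) (cardX : #|X| = (s ^ 2).+1).

Let S_gt0 : 0 < s%:R :> R. Proof. by rewrite ltr0n. Qed.

Let sphT n g : (g \in word_sphere ellH ts n) = (ellH g == n).
Proof. exact: (mem_word_sphere normT). Qed.

(** Here the growth of [H] enters: spheres of radius [j] have at most [s ^ j]
    elements. *)
Lemma sum_norm_ball_le N :
  \sum_(a <- norm_ball (word_sphere ellH ts) N) s%:R ^- ellH a <= N.+1%:R :> R.
Proof.
rewrite big_norm_ball -[X in _ <= X%:R]card_ord -sum1_card natr_sum.
apply: ler_sum => j _.
rewrite (eq_big_seq (fun=> s%:R ^- j)) => [|a]; last by rewrite sphT => /eqP ->.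
rewrite big_const_seq count_predT iter_addr_0 -[leLHS]mulr_natr mulrC.
rewrite ler_pdivrMr ?exprn_gt0 // mul1r -natrX ler_nat.
rewrite (leq_trans (size_word_sphere_le _ _ _)) //.
by case: (nat_of_ord j) => // k; rewrite leq_exp2r.
Qed.

Lemma fi_ball_weight N (b : free_involutions X) :
  \sum_(a <- norm_ball (@fi_sphere X) N)
    s%:R ^- fi_size a * s%:R ^- fi_size (a^-1 * b)%g <=
  N.+1%:R ^+ 2 * s%:R ^- fi_size b :> R.
Proof.
have odd_sum n : (\sum_(j < n) (2 * j + 1) = n ^ 2)%N.
  by elim: n => [|n IHn]; rewrite ?big_ord0 // big_ord_recr /= IHn; ring.
rewrite big_norm_ball -natrX -odd_sum natr_sum mulr_suml.
apply: ler_sum => j _.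
rewrite (eq_big_seq (fun a => s%:R ^- j * s%:R ^- fi_size (a^-1 * b)%g)) => [|a];
  last by rewrite mem_fi_sphere => /eqP ->.
rewrite -mulr_sumr mulrC ler_pdivrMr ?exprn_gt0 // mulrAC.
exact: fi_sphere_weight.
Qed.

(** The Schur sum over a product of balls factors: [H] contributes [N + 1] and [F]
    contributes [(N + 1) ^ 2]. *)
Theorem product_has_RRD :
  has_RRD (fun g : H * free_involutions X =>
    (product_norm ellH (@fi_size X) g)%:R : R).
Proof.
pose ballH := norm_ball (word_sphere ellH ts).
pose ballF := norm_ball (@fi_sphere X).
have ballHP N a : (a \in ballH N) = (ellH a <= N)%N by exact: mem_norm_ball.
have ballFP N a : (a \in ballF N) = (fi_size a <= N)%N.
  by apply: mem_norm_ball => n b; exact: mem_fi_sphere.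
have normF := fi_word_norm X; have genF := fi_generating X.
pose Z N := [seq (a, b) | a <- ballH N, b <- ballF N].
have memZ N g : (g \in Z N) = (ellH g.1 <= N)%N && (fi_size g.2 <= N)%N.
  apply/allpairsP/andP => [[[a b] /= [+ + ->]]|[g1 g2]].
    by rewrite ballHP ballFP.
  by exists g; rewrite ballHP ballFP; split=> //; case: (g).
apply: (@has_RRD_of_weight R _ _ s%:R (fun g => s%:R ^- fi_size g.2) Z 3) => //.
- by move=> g; rewrite /product_norm (normV genT normT) (normV genF normF).
(* The sphere through g contains a whole sphere of 1 * F. *)
- move=> g; set n := product_norm _ _ g.
  exists [seq (1%g, b) | b <- fi_sphere X n]; split.
  + by rewrite map_inj_uniq ?fi_sphere_uniq // => b c [].
  + move=> _ /mapP[b + ->]; rewrite mem_fi_sphere => /eqP bn.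
    by rewrite /product_norm /= (norm1 normT) bn.
  + by rewrite -natrX ler_nat size_map size_fi_sphere.
- move=> N; apply: allpairs_uniq.
  + by apply: norm_ball_uniq => // j; exact: word_sphere_uniq.
  + apply: norm_ball_uniq => [n b|j]; last exact: fi_sphere_uniq.
    exact: mem_fi_sphere.
  + by move=> [a b] [c d] _ _ /= [-> ->].
- move=> N g le_N; rewrite memZ !(leq_trans _ le_N) // ?leq_addl //.
  exact: leq_addr.
- by move=> N g; rewrite !memZ (normV genT normT) (normV genF normF).
- by move=> g; rewrite invr_gt0 exprn_gt0.
- move=> N [a0 b0]; rewrite big_allpairs /=.
  under eq_bigr => a _.
    under eq_bigr do rewrite /product_norm /= exprD invfM -mulrA.
    rewrite -mulr_sumr; over.
  rewrite -mulr_suml exprS -mulrA; apply: ler_pM.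
  + by apply: sumr_ge0 => a _; rewrite invr_ge0 exprn_ge0 // ltW.
  + by apply: sumr_ge0 => b _; rewrite mulr_ge0 // invr_ge0 exprn_ge0 // ltW.
  + exact: sum_norm_ball_le.
  + exact: fi_ball_weight.
Qed.

End ProductRRD.

(** * The lamplighter group *)

Section Lamplighter.
Implicit Types (A B C : {fset int}) (p q r x : int).

Definition shift p A : {fset int} := ((fun x => x + p)%R @` A)%fset.

Definition symdiff A B : {fset int} := ((A `\` B) `|` (B `\` A))%fset.

Lemma in_shift p A x : (x \in shift p A) = (x - p \in A).
Proof.
apply/imfsetP/idP => [[y yA ->]|xA]; first by rewrite addrK.
by exists (x - p); rewrite ?subrK.
Qed.

Lemma in_symdiff A B x : (x \in symdiff A B) = (x \in A) (+) (x \in B).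
Proof. by rewrite !inE; case: (x \in A); case: (x \in B). Qed.

(** The lit lamps and the position of the lamplighter. *)
Definition lamplighter : Type := ({fset int} * int)%type.
HB.instance Definition _ := Choice.copy lamplighter ({fset int} * int)%type.

Implicit Types g h : lamplighter.

Definition lamp_one : lamplighter := (fset0, 0).
(** The lamps of [g] are moved along by the position of [h].  With this convention
    a word read from its right end is a walk of the lamplighter: [step] moves him
    and [lamp] switches the lamp where he stands ([step_mulE], [lamp_mulE]). *)
Definition lamp_mul g h : lamplighter := (symdiff (shift h.2 g.1) h.1, g.2 + h.2).
Definition lamp_inv g : lamplighter := (shift (- g.2) g.1, - g.2).

Lemma lamp_mulA : associative lamp_mul.
Proof.
move=> [A p] [B q] [C r]; congr (_, _); last by rewrite /= addrA.
apply/fsetP => x; rewrite !(in_symdiff, in_shift) addbA /=.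
by rewrite opprD addrA -!addrA [- q - r]addrC.
Qed.

Lemma lamp_mul1 : left_id lamp_one lamp_mul.
Proof.
move=> [A p]; congr (_, _); last by rewrite /= add0r.
by apply/fsetP => x; rewrite in_symdiff in_shift inE.
Qed.

Lemma lamp_mulr1 : right_id lamp_one lamp_mul.
Proof.
move=> [A p]; congr (_, _); last by rewrite /= addr0.
by apply/fsetP => x; rewrite in_symdiff in_shift inE addbF subr0.
Qed.

Lemma lamp_mulV : left_inverse lamp_one lamp_inv lamp_mul.
Proof.
move=> [A p]; congr (_, _); last by rewrite /= addNr.
by apply/fsetP => x; rewrite in_symdiff !in_shift inE opprK subrK addbb.
Qed.

Lemma lamp_mulrV : right_inverse lamp_one lamp_inv lamp_mul.
Proof.
move=> [A p]; congr (_, _); last by rewrite /= addrN.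
by apply/fsetP => x; rewrite in_symdiff !in_shift inE addbb.
Qed.

HB.instance Definition _ := isGroup.Build lamplighter
  lamp_mulA lamp_mul1 lamp_mulr1 lamp_mulV lamp_mulrV.

Lemma lampM g h : (g * h)%g = (symdiff (shift h.2 g.1) h.1, g.2 + h.2).
Proof. by []. Qed.

Definition lamp : lamplighter := ([fset 0]%fset, 0).
Definition step p : lamplighter := (fset0, p).

Definition lamp_gens : seq lamplighter := [:: lamp; step 1; step (-1)].

Lemma lamp_mulE A p : (lamp * (A, p))%g = (symdiff [fset p]%fset A, p).
Proof.
rewrite lampM add0r; congr (symdiff _ _, _); apply/fsetP => x.
by rewrite in_shift !inE subr_eq0.
Qed.

Lemma step_mulE q A p : (step q * (A, p))%g = (A, q + p).
Proof.
rewrite lampM; congr (_, _); apply/fsetP => x.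
by rewrite in_symdiff in_shift inE.
Qed.

Definition confined (m : nat) g : Prop :=
  (`|g.2| <= m)%N /\ forall x, x \in g.1 -> (`|x| <= m)%N.

(** Within [m] moves the lamplighter neither goes nor switches anything farther
    than [m]. *)
Lemma words_confined g w : words [set` lamp_gens] g w -> confined (size w) g.
Proof.
move=> [+ <-]; elim: w => [|s w IHw] ws; first by rewrite big_nil; split.
rewrite big_cons; move: (\prod_(t <- w) t)%g IHw => -[A p] IHw.
have [p_le A_le] : (`|p| <= size w)%N /\ forall x, x \in A -> (`|x| <= size w)%N.
  by apply: IHw => t tw; apply: ws; rewrite inE tw orbT.
have := ws s (mem_head _ _); rewrite /= !inE => /or3P[]/eqP ->.
- rewrite lamp_mulE; split=> [|x]; first exact: leqW.
  rewrite in_symdiff inE; have [-> _|_ /A_le] := eqVneq x p; exact: leqW.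
- rewrite step_mulE; split=> [|x /A_le]; last exact: leqW.
  by have : (`|(1 + p)%R| <= (size w).+1)%N by lia.
- rewrite step_mulE; split=> [|x /A_le]; last exact: leqW.
  by have : (`|(- 1 + p)%R| <= (size w).+1)%N by lia.
Qed.

Local Notation T := [set` lamp_gens].

Lemma lamp_generating : finite_symmetric_generating T.
Proof.
have stepV p : ((step p)^-1)%g = step (- p).
  by congr (_, _); apply/fsetP => x; rewrite in_shift !inE.
have genM g h : words T g !=set0 -> words T h !=set0 -> words T (g * h)%g !=set0.
  by move=> [u Tu] [v Tv]; exists (u ++ v); exact: words_cat.
have gen1 g : g \in lamp_gens -> words T g !=set0.
  move=> Tg; exists [:: g]; split; last by rewrite big_seq1.
  by move=> s; rewrite inE => /eqP ->.
have symT s : T s -> T (s^-1)%g.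
  rewrite /= !inE => /or3P[]/eqP ->.
  - apply/or3P/Or31/eqP; congr (_, _).
    by apply/fsetP => x; rewrite in_shift /= oppr0 subr0.
  - by rewrite stepV eqxx !orbT.
  - by rewrite stepV opprK eqxx !orbT.
have gen_step p : words T (step p) !=set0.
  have gen_nat (n : nat) e : step e \in lamp_gens -> words T (step (e *+ n)) !=set0.
    move=> Te; elim: n => [|n IHn]; first by exists [::]; exact: words1.
    have -> : step (e *+ n.+1) = (step e * step (e *+ n))%g.
      by rewrite mulrS; exact/esym/step_mulE.
    by apply: (genM _ _) => //; exact: gen1.
  case: p => n.
    by rewrite -[Posz n]natz; apply: gen_nat; rewrite !inE eqxx !orbT.
  have -> : Negz n = (- 1) *+ n.+1 by rewrite NegzE mulNrn natz.
  by apply: gen_nat; rewrite !inE eqxx !orbT.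
split=> //; first exact: finite_seq.
case=> A p; have -> : (A, p) = (step p * (A, 0))%g by rewrite step_mulE addr0.
apply: (genM _ _) => //; elim/fset1U_rect: A => [|x A xA IHA].
  exact: gen_step.
(* Walk to x, switch the lamp there, and walk back. *)
have -> : ((x |` A)%fset, 0) = (step (- x) * (lamp * (step x * (A, 0))))%g.
  rewrite (step_mulE x) lamp_mulE step_mulE addr0 addNr; congr (_, _).
  apply/fsetP => y; rewrite in_symdiff !inE.
  by have [->|] := eqVneq y x => //=; rewrite (negPf xA).
by do !apply: (genM _ _) => //; apply: (gen1 _); rewrite inE eqxx.
Qed.

Definition initial (n : nat) : {fset int} :=
  [fset x in [seq i%:Z | i <- iota 0 n]]%fset.

Lemma in_initial n x : (x \in initial n) = (0 <= x < n%:Z).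
Proof.
rewrite !inE; apply/mapP/idP => [[k]|x_bnd].
  by rewrite mem_iota => /andP[_ ?] ->; lia.
by exists `|x|%N; rewrite ?mem_iota; lia.
Qed.

Lemma card_initial n : #|` initial n| = n.
Proof.
rewrite /initial card_fseq undup_id ?size_map ?size_iota //.
by rewrite map_inj_uniq ?iota_uniq // => i j [].
Qed.

(** A single walk from [0] to [n] can switch any of the [n] lamps on its way, which
    gives the exponential growth. *)
Lemma short_word n A : (A `<=` initial n)%fset ->
  exists2 w, words T (A, n%:Z) w & (size w <= 2 * n)%N.
Proof.
elim: n A => [|n IHn] A /fsubsetP AI.
  exists [::] => //; suff -> : A = fset0 by exact: words1.
  by apply/fsetP => x; rewrite inE; apply/negP => /AI; rewrite in_initial; lia.
have [|w Tw w_le] := IHn (A `\ n%:Z)%fset.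
  apply/fsubsetP => x; rewrite in_fsetD1 => /andP[xn /AI].
  by rewrite !in_initial; lia.
have stepT : T (step 1) by rewrite /= !inE eqxx orbT.
have nS : n.+1%:Z = 1 + n%:Z by lia.
have [nA|nA] := boolP (n%:Z \in A).
  exists (step 1 :: lamp :: w); last by rewrite mulnS.
  have -> : (A, n.+1%:Z) = (step 1 * (lamp * ((A `\ n%:Z)%fset, n%:Z)))%g.
    rewrite lamp_mulE step_mulE nS; congr (_, _); apply/fsetP => x.
    by rewrite in_symdiff !inE; have [->|] := eqVneq x n%:Z.
  by do !apply: words_cons => //; rewrite /= inE eqxx.
exists (step 1 :: w); last by rewrite mulnS ltnW.
have -> : (A, n.+1%:Z) = (step 1 * ((A `\ n%:Z)%fset, n%:Z))%g.
  rewrite step_mulE nS; congr (_, _); apply/fsetP => x; rewrite !inE.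
  by have [->|] := eqVneq x n%:Z; rewrite ?(negPf nA).
exact: words_cons.
Qed.

(** [E] consists of all states with the lamplighter and the lit lamps in [[0, M)],
    and [E0] of those where he is at distance at least [m] from both ends: by
    confinement, a left factor of norm at most [m] cannot lead out of [E]. *)
Lemma lamp_folner ell (n : nat) : word_norm T ell ->
  exists B E0 E : seq lamplighter,
    [/\ uniq B, forall g, (g \in B) = (ell g <= 2 * n)%N & (2 ^ n <= size B)%N] /\
    [/\ uniq E0, uniq E, E0 != [::], (size E <= 2 * size E0)%N &
      forall b e, b \in B -> e \in E0 -> (b * e)%g \in E].
Proof.
move=> normT; pose m := (2 * n)%N; pose M := (4 * m.+1)%N.
have sphT j g : (g \in word_sphere ell lamp_gens j) = (ell g == j).
  exact: (mem_word_sphere normT).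
pose B := norm_ball (word_sphere ell lamp_gens) m.
have memB g : (g \in B) = (ell g <= m)%N by exact: mem_norm_ball.
have uB : uniq B by apply: (norm_ball_uniq sphT); move=> j; exact: word_sphere_uniq.
(* M = 4 m + 4 is large enough for half of the positions to be central. *)
pose box (a b : nat) : seq lamplighter :=
  [seq (A, i%:Z) | A <- fpowerset (initial M), i <- iota a b].
have ubox a b : uniq (box a b).
  apply: allpairs_uniq; rewrite ?iota_uniq ?fset_uniq //.
  by move=> -[A i] [C j] _ _ [-> ->].
have sbox a b : size (box a b) = (2 ^ M * b)%N.
  by rewrite size_allpairs size_iota card_fpowerset card_initial.
exists B, (box m (M - 2 * m)%N), (box 0%N M); split; split=> //.
- pose r := [seq ((A, n%:Z) : lamplighter) | A <- fpowerset (initial n)].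
  have <- : size r = (2 ^ n)%N by rewrite size_map card_fpowerset card_initial.
  apply: uniq_leq_size; first by rewrite map_inj_uniq ?fset_uniq // => A C [].
  move=> _ /mapP[A + ->]; rewrite fpowersetE => /short_word[w Tw w_le].
  by rewrite memB (leq_trans (norm_minimal normT Tw)).
- by rewrite -size_eq0 sbox muln_eq0 expn_eq0 /=; lia.
- by rewrite !sbox mulnCA leq_mul2l; apply/orP; right; lia.
move=> [A p] e; rewrite memB => Am /allpairsP[[C k] /= [+ + ->]].
(* Recasts k at type nat itself, for the arithmetic below. *)
have [i <-] : exists i : nat, i = k by exists k.
rewrite fpowersetE mem_iota => /fsubsetP CM i_bnd.
have [w Tw wE] := norm_attained normT (A, p).
have [p_le A_le] : confined (size w) (A, p) := words_confined Tw.
have w_le : (size w <= m)%N by rewrite wE.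
have ME : M = (4 * m.+1)%N by [].
have {}p_le : (`|p| <= size w)%N := p_le.
have pi_ge0 : 0 <= p + i%:Z by lia.
have pi_lt : p + i%:Z < M%:Z by lia.
have -> : (((A, p) : lamplighter) * ((C, i%:Z) : lamplighter))%g =
    (symdiff (shift i%:Z A) C, `|(p + i%:Z)%R|%N%:Z).
  by rewrite lampM gez0_abs.
apply: allpairs_f; last by rewrite mem_iota /=; lia.
rewrite fpowersetE; apply/fsubsetP => x; rewrite in_symdiff in_shift in_initial.
case: (boolP (x \in C)) => [/CM|_]; first by rewrite in_initial.
by rewrite addbF => /A_le; lia.
Qed.

End Lamplighter.

(** * The factors of the counterexample *)

(** [H] itself, under another name, is made a subgroup of [H * F] through
    [h |-> (h, 1)], so that words and norms in the subgroup are those of [H]. *)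
Definition left_factor (H F : groupType) : Type := H.

Section LeftFactor.
Variables H F : groupType.

Definition in_left_factor : pred (H * F) := fun g => g.2 == 1%g.

Local Notation factor := (left_factor H F).
HB.instance Definition _ := Group.copy factor H.

Definition left_inj (h : factor) : H * F := (h, 1%g).

Lemma left_rect (K : factor -> Type) :
  (forall g (_ : in_left_factor g), K g.1) -> forall h, K h.
Proof. by move=> Kg h; apply: (Kg (left_inj h)); rewrite /in_left_factor /=. Qed.

Lemma left_injK g (Fg : in_left_factor g) : left_inj g.1 = g.
Proof. by case: g Fg => a b /eqP /= ->. Qed.

HB.instance Definition _ := isSub.Build (H * F)%type in_left_factor factor
  left_rect left_injK.

Lemma left_injM : {morph (val : factor -> H * F) : g h / (g * h)%g}.
Proof. by move=> g h; congr (_, _); rewrite mulg1. Qed.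

HB.instance Definition _ :=
  isSubMagma.Build (H * F)%type in_left_factor factor left_injM.

HB.instance Definition _ :=
  isSubBaseUMagma.Build (H * F)%type in_left_factor factor erefl.

End LeftFactor.

Section Failure.
Variables (R : realType) (ell : lamplighter -> nat).
Hypothesis ellP : word_norm [set` lamp_gens] ell.

Lemma lamplighter_not_RRD : ~ has_RRD (fun g => (ell g)%:R : R).
Proof.
move=> [P decay]; have [n fails] := decay_bound_fails (fun g => (ell g)%:R : R) P.
have [B [E0 [E [[uB memB sB] folner]]]] := lamp_folner n ellP.
have [|suppB] := fails B E0 E _ folner.
  by split=> // b; rewrite memB ler0n ler_nat.
apply; apply: decay => //; first exact: finitely_supported_indicator.
by move=> g h /eqP; rewrite eqr_nat => /eqP gh; rewrite /indicator !memB gh.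
Qed.

Lemma lamplighter_product_not_RD (F : groupType) (ellF : F -> nat) :
  ellF 1%g = 0%N ->
  ~ has_RD (fun g : lamplighter * F => (product_norm ell ellF g)%:R : R).
Proof.
move=> ellF1 [P decay].
have [n fails] :=
  decay_bound_fails (fun g : lamplighter * F => (product_norm ell ellF g)%:R : R) P.
have [B [E0 [E [[uB memB sB] [uE0 uE E0_neq0 sE BE0]]]]] := lamp_folner n ellP.
pose inj (h : lamplighter) : lamplighter * F := (h, 1%g).
have injI : injective inj by move=> g h [].
have [||suppB] := fails (map inj B) (map inj E0) (map inj E).
- split; rewrite ?map_inj_uniq ?size_map // => _ /mapP[b + ->].
  by rewrite memB /product_norm /= ellF1 addn0 ler0n ler_nat.
- split; rewrite ?map_inj_uniq ?size_map // -?size_eq0 ?size_map ?size_eq0 //.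
  move=> _ _ /mapP[b bB ->] /mapP[e eE0 ->]; apply/mapP; exists (b * e)%g.
    exact: BE0.
  by congr (_, _); rewrite mulg1.
by apply; apply: decay => //; exact: finitely_supported_indicator.
Qed.

End Failure.

Theorem corollary2 (R : realType) :
  exists (G : groupType) (L : G -> R),
    finitely_generated G /\
    length_function L /\
    proper_length L /\
    (exists2 S : set G, finite_symmetric_generating S &
       quasi_isometric L (word_length R S)) /\
    (has_RRD L /\ ~ has_RD L) /\
    (exists (B : pred G) (H : subGroupType B) (T : set H),
       finite_symmetric_generating T /\ ~ has_RRD (word_length R T)).
Proof.
have [ell ellP] := exists_word_norm lamp_generating.
pose X := 'I_(3 ^ 2).+1.
have cardX : #|X| = (3 ^ 2).+1 by rewrite card_ord.
have normF := fi_word_norm X; have genF := fi_generating X.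
pose G : groupType := (lamplighter * free_involutions X)%type.
pose normG := product_norm ell (@fi_size X).
have genG := product_generating lamp_generating ellP genF normF.
have normGP := product_word_norm ellP normF.
exists G, (fun g => (normG g)%:R).
split; first by eexists; exact: genG.
split; first exact: norm_length_function genG normGP R.
split; first exact: norm_proper genG normGP R.
split.
  eexists; first exact: genG.
  rewrite (word_lengthE R normGP); exists 1 => // g.
  by rewrite invr1 mul1r; split; [rewrite gerBl|rewrite lerDl].
split; last first.
  exists (@in_left_factor _ _), (@left_factor lamplighter (free_involutions X)).
  exists [set` lamp_gens]; split; first exact: lamp_generating.
  rewrite (@word_lengthE lamplighter R _ _ ellP); exact: lamplighter_not_RRD.
split.
  exact: (@product_has_RRD R _ _ _ lamp_gens 3 X lamp_generating ellP).
exact: (lamplighter_product_not_RD ellP (norm1 normF)).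
Qed.
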